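(* Let $n\ge 2$ and let $\Gamma$ be a generalized Hantzsche-Wendt group of dimension $n$. Then $\Gamma$ has a subgroup isomorphic (as an abstract group) to a generalized Hantzsche-Wendt group of dimension $n-1$.
   Context: A Bieberbach group of dimension (or rank) $n$ is a torsion-free, discrete, cocompact subgroup $\Gamma$ of $\mathrm{E}(n)=\mathrm{O}(n)\ltimes\mathbb{R}^n$, the group of rigid motions of $\mathbb{R}^n$ with product $(B,b)(C,c)=(BC,Bc+b)$. Its translation subgroup $\Lambda\cong\mathbb{Z}^n$ is normal of finite index, and $\Gamma/\Lambda\cong\{B:(B,b)\in\Gamma\}$ is its holonomy group. A Bieberbach group of dimension $n$ is a generalized Hantzsche-Wendt (GHW) group if its holonomy group is isomorphic to $\mathbb{Z}_2^{\,n-1}$. In dimension $1$ this means an infinite cyclic group of translations of $\mathbb{R}$. *)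

(* Defs.v *)
From HB Require Import structures.
From mathcomp Require Import all_boot all_algebra.
From mathcomp Require Import all_classical all_reals all_analysis.
Import GRing.Theory.
Import numFieldNormedType.Exports.

Set Implicit Arguments.
Unset Strict Implicit.
Unset Printing Implicit Defensive.

Local Open Scope classical_set_scope.
Local Open Scope ring_scope.

(* A subgroup of a group G : groupType is an element of groupClosed G. *)

Section Groups.
Variables G H : groupType.

Definition group_isomorphic (A : set G) (B : set H) : Prop :=
  exists2 f : G -> H,
    {in A &, {morph f : x y / (x * y)%g}} & set_bij A B f.

Definition torsion_free (S : groupClosed G) : Prop :=
  forall g k, g \in S -> (0 < k)%N -> (g ^+ k = 1)%g -> g = 1%g.

(* The quotients of coset_rel S are the cosets g S. *)
Definition coset_rel (S : groupClosed G) : rel G :=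
  fun x y => (x^-1 * y)%g \in S.

Lemma coset_rel_refl S : reflexive (coset_rel S).
Proof. by move=> x; rewrite /coset_rel mulVg gpred1. Qed.

Lemma coset_rel_sym S : symmetric (coset_rel S).
Proof. by move=> x y; rewrite /coset_rel -gpredV invgM invgK. Qed.

Lemma coset_rel_trans S : transitive (coset_rel S).
Proof.
move=> y x z xy yz; rewrite /coset_rel.
by have := gpredM _ _ xy yz; rewrite mulgA mulgK.
Qed.

Canonical coset_equiv S :=
  EquivRel (coset_rel S) (@coset_rel_refl S) (@coset_rel_sym S)
    (@coset_rel_trans S).

End Groups.

Section Orthogonal.
Variables (R : realType) (n : nat).

Record orthogonal_group := Orthogonal {
  orth_mx :> 'M[R]_n;
  orth_mxP : orth_mx *m orth_mx^T == 1%:M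
}.

HB.instance Definition _ := [isSub for orth_mx].
HB.instance Definition _ := [Choice of orthogonal_group by <:].
HB.instance Definition _ :=
  Topological.copy orthogonal_group (initial_topology orth_mx).

Fact orth1_subproof : (1%:M : 'M[R]_n) *m 1%:M^T == 1%:M.
Proof. by rewrite trmx1 mulmx1. Qed.

Fact orthM_subproof (A B : orthogonal_group) : A *m B *m (A *m B)^T == 1%:M.
Proof.
rewrite trmx_mul mulmxA -(mulmxA (A : 'M[R]_n)) (eqP (orth_mxP B)) mulmx1.
exact: orth_mxP.
Qed.

Fact orthV_subproof (A : orthogonal_group) : (A : 'M[R]_n)^T *m A^T^T == 1%:M.
Proof. by rewrite trmxK; apply/eqP/mulmx1C/eqP/orth_mxP. Qed.

Definition orth1 := Orthogonal orth1_subproof.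
Definition orthM A B := Orthogonal (orthM_subproof A B).
Definition orthV A := Orthogonal (orthV_subproof A).

Fact orthMA : associative orthM.
Proof. by move=> A B C; apply: val_inj; rewrite /= mulmxA. Qed.
Fact orth1M : left_id orth1 orthM.
Proof. by move=> A; apply: val_inj; rewrite /= mul1mx. Qed.
Fact orthM1 : right_id orth1 orthM.
Proof. by move=> A; apply: val_inj; rewrite /= mulmx1. Qed.
Fact orthVM : left_inverse orth1 orthV orthM.
Proof.
by move=> A; apply: val_inj => /=; apply: mulmx1C; apply/eqP/orth_mxP.
Qed.
Fact orthMV : right_inverse orth1 orthV orthM.
Proof. by move=> A; apply: val_inj => /=; apply/eqP/orth_mxP. Qed.

HB.instance Definition _ :=
  isGroup.Build orthogonal_group orthMA orth1M orthM1 orthVM orthMV.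

End Orthogonal.

Section Motion.
Variables (R : realType) (n : nat).

(* E(n), with the product topology of O(n) x R^n but the semidirect product
   group law. *)
Definition motion : Type := (orthogonal_group R n * 'cV[R]_n)%type.

HB.instance Definition _ :=
  Topological.copy motion (orthogonal_group R n * 'cV[R]_n)%type.

Definition motion1 : motion := (1%g, 0).
Definition motionM (g h : motion) : motion :=
  ((g.1 * h.1)%g, (g.1 : 'M[R]_n) *m h.2 + g.2).
Definition motionV (g : motion) : motion :=
  (g.1^-1%g, - ((g.1^-1%g : orthogonal_group R n) : 'M[R]_n) *m g.2).

Fact motionMA : associative motionM.
Proof.
move=> [A a] [B b] [C c]; congr (_, _) => /=; first exact: mulgA.
by rewrite mulmxDr mulmxA addrA.
Qed.
Fact motion1M : left_id motion1 motionM.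
Proof.
by move=> [A a]; congr (_, _) => /=; [exact: mul1g | rewrite mul1mx addr0].
Qed.
Fact motionM1 : right_id motion1 motionM.
Proof.
by move=> [A a]; congr (_, _) => /=; [exact: mulg1 | rewrite mulmx0 add0r].
Qed.
Fact motionVM : left_inverse motion1 motionV motionM.
Proof.
move=> [A a]; congr (_, _) => /=; first exact: mulVg.
by rewrite mulNmx subrr.
Qed.
Fact motionMV : right_inverse motion1 motionV motionM.
Proof.
move=> [A a]; congr (_, _) => /=; first exact: mulgV.
by rewrite mulNmx mulmxN mulmxA (eqP (orth_mxP A)) mul1mx addNr.
Qed.

HB.instance Definition _ :=
  isGroup.Build motion motionMA motion1M motionM1 motionVM motionMV.

Implicit Type Gam : groupClosed motion.

Definition discrete_subgroup Gam : Prop := [set` Gam] `<=` isolated [set` Gam].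

Definition cocompact_subgroup Gam : Prop :=
  compact [set: quotient_topology {eq_quot (coset_rel Gam)}%qT].

Definition bieberbach Gam : Prop :=
  [/\ torsion_free Gam, discrete_subgroup Gam & cocompact_subgroup Gam].

Definition holonomy Gam : set (orthogonal_group R n) := [set g.1 | g in [set` Gam]].

(* Only meant for n >= 1.  The groupType structure of 'rV['Z_2]_n.-1 is its
   additive group. *)
Definition generalized_HW Gam : Prop :=
  bieberbach Gam /\ group_isomorphic (holonomy Gam) [set: 'rV['Z_2]_n.-1].

End Motion.

(* Main.v *)
From HB Require Import structures.
Require Import Defs.
From mathcomp Require Import all_boot all_order all_algebra.
From mathcomp Require Import all_classical all_reals all_analysis.
From mathcomp Require Import ring lra zify.
Import Order.TTheory GRing.Theory Num.Theory.
Import numFieldNormedType.Exports.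

(** The holonomy of Gam is an elementary abelian 2-group
of orthogonal matrices, so it can be diagonalised.  Its elements become sign
matrices, and the holonomy becomes a subgroup V of index 2 in F_2^n.  It does
not contain -1: a motion with linear part -1 is an involution, and Gam is
torsion-free.  Hence any two coordinates are separated by an element of V
(index_le2_separates), so the common eigenlines are pairwise orthogonal and
Gam may be conjugated by an orthogonal matrix to a group of diagonal motions
(orthogonal_diagonalisation).

The basis vectors e_i generate F_2^n, so some e_i lies outside V.  Every
motion of Gam acts on the i-th coordinate as x -> +x + t or x -> -x + t.
Choose a level c which is the centre of one of these reflections, if there is
any, and let Del be the stabiliser of the hyperplane x_i = c.  Since e_i is not
in V, forgetting the i-th coordinate is injective on Del; its image is Gam'.
Gam' is torsion-free as Del is.  It is discrete because its translations are
those of Gam that are orthogonal to the i-th axis, and its holonomy is finite.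
It is cocompact because Gam contains a nonzero translation along every axis
(axis_translation), and those along the axes other than i lie in Del.

The size of the holonomy of Gam' remains.  The translations of R which Gam
induces on the i-th coordinate form a discrete, hence cyclic, group.  Squares
have trivial signs, so the signs of an element of Gam agree, modulo the signs of
Del, with 0 or with those of an element that induces a generator (ex_level).
Hence the signs of Del have index at most 2 in V, and V maps isomorphically onto
F_2^{n-1} when the i-th coordinate is deleted.  The signs of Gam' thus have index
at most 2 in F_2^{n-1}, and exactly 2 because the holonomy of Gam' does not
contain -1 either.  Some e_j lies outside them, and deleting the j-th coordinate
identifies them with F_2^{n-2} (GHW_of_signs). *)

Set Implicit Arguments.
Unset Strict Implicit.
Unset Printing Implicit Defensive.

Local Open Scope classical_set_scope.
Local Open Scope ring_scope.

(** * Subgroups of index at most 2 in F_2^m *)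

Section SignVectors.

Lemma addZ2 (a : 'Z_2) : a + a = 0.
Proof. by case: a => [[|[|]]] //= ?; apply: val_inj. Qed.

Lemma Z2_cases (a : 'Z_2) : a = 0 \/ a = 1.
Proof. by case: a => [[|[|]]] //= ?; [left|right]; apply: val_inj. Qed.

Variable m : nat.
Implicit Types (x y v w : 'rV['Z_2]_m) (V : set 'rV['Z_2]_m).

Lemma sign_addxx x : x + x = 0.
Proof. by apply/rowP => j; rewrite !mxE addZ2. Qed.

Lemma sign_opp x : - x = x.
Proof. by apply/eqP; rewrite eq_sym -addr_eq0 sign_addxx. Qed.

(** The last clause says that there is at most one nontrivial coset.  This form
    needs no cardinals, and it follows at once when every vector is known to lie
    in [V] or in one fixed coset. *)
Record index_le2 V : Prop := IndexLe2 {
  idx0 : V 0;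
  idxD : forall x y, V x -> V y -> V (x + y);
  idxN : forall x y, ~ V x -> ~ V y -> V (x + y)
}.

(** The basis vectors generate F_2^m, so a subgroup containing all of them is
    not proper. *)
Lemma ex_delta_notin V w : index_le2 V -> ~ V w -> exists i, ~ V (delta_mx 0 i).
Proof.
move=> HV; apply: contra_notP => /forallNP H.
rewrite (row_sum_delta w); elim/big_ind : _ => [|x y Vx Vy|i _].
- exact: idx0.
- exact: idxD.
- have [->|->] := Z2_cases (w 0 i); first by rewrite scale0r; exact: idx0.
  by rewrite scale1r; apply: contrapT; exact: H.
Qed.

(** With [1] the all-ones vector, either [e_i] or [1 + e_i] is in [V], and both
    of them tell [i] from [j]. *)
Lemma index_le2_separates V i j : index_le2 V -> ~ V (const_mx 1) -> i != j ->
  exists2 v, V v & v 0 i != v 0 j.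
Proof.
move=> HV V1 ij; have [Vd|Vd] := pselect (V (delta_mx 0 i)).
  by exists (delta_mx 0 i) => //; rewrite !mxE !eqxx (eq_sym j) (negPf ij).
exists (const_mx 1 + delta_mx 0 i); first exact: idxN.
by rewrite !mxE !eqxx (eq_sym j) (negPf ij).
Qed.

(** A vector outside the image, added to the image, gives a second coset of the
    same size; the two together have 2^m elements, so there is no third. *)
Lemma codom_index_le2 k (u : 'rV['Z_2]_k -> 'rV['Z_2]_m) :
  m = k.+1 -> injective u -> {morph u : x y / x + y} -> index_le2 (range u).
Proof.
move=> mk uinj uD; have u0 : u 0 = 0.
  by apply: (addrI (u 0)); rewrite -uD !addr0.
split=> [|_ _ [a _ <-] [b _ <-]|x y ux uy].
- by exists 0.
- by exists (a + b); rewrite ?uD.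
(* An injection from two copies of F_2^k, which is onto for reasons of size. *)
pose f (p : bool * 'rV['Z_2]_k) := (if p.1 then x else 0) + u p.2.
have finj : injective f.
  move=> [[] a] [[] b]; rewrite /f /= ?add0r => E.
  - by move/addrI/uinj: E => ->.
  - exfalso; apply: ux; exists (a + b) => //.
    by rewrite uD -E addrC -addrA sign_addxx addr0.
  - exfalso; apply: ux; exists (a + b) => //.
    by rewrite uD E -addrA sign_addxx addr0.
  - by move/uinj: E => ->.
have : y \in codom f.
  apply: inj_card_onto => //.
  by rewrite card_prod card_bool !card_mx mk !mul1n card_ord expnS.
case/codomP => -[[] a] /=; rewrite /f /= => yE.
  by exists a => //; rewrite yE addrA sign_addxx add0r.
by exfalso; apply: uy; exists a => //; rewrite yE add0r.
Qed.

End SignVectors.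

Section Delete.
Variable m : nat.
Implicit Types (V : set 'rV['Z_2]_m.+1) (i : 'I_m.+1).

Lemma col'_eq0 i (x : 'rV['Z_2]_m.+1) :
  col' i x = 0 -> x = 0 \/ x = delta_mx 0 i.
Proof.
move=> x0; have xl k : x 0 (lift i k) = 0.
  by move/rowP/(_ k): x0; rewrite !mxE.
have [xi|xi] := Z2_cases (x 0 i); [left|right]; apply/rowP => j; rewrite !mxE;
  have [k ->|->] := unliftP i j; rewrite ?xl ?xi ?eqxx //.
by rewrite (eq_sym _ i) (negPf (neq_lift i k)).
Qed.

(** The kernel of the deletion of the coordinate [i] is [{0, e_i}], which meets
    [V] trivially. *)
Lemma col'_inj_in V i : index_le2 V -> ~ V (delta_mx 0 i) ->
  forall x y, V x -> V y -> col' i x = col' i y -> x = y.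
Proof.
move=> HV Vi x y Vx Vy E.
have : col' i (x + y) = 0 by rewrite linearD /= E sign_addxx.
case/col'_eq0 => xy; first by rewrite -(sign_opp y); apply/eqP; rewrite -addr_eq0 xy.
by exfalso; apply: Vi; rewrite -xy; exact: idxD.
Qed.

(** Of the two vectors over [w], which differ by [e_i], one is in [V]. *)
Lemma col'_onto V i w : index_le2 V -> ~ V (delta_mx 0 i) ->
  exists2 v, V v & col' i v = w.
Proof.
move=> HV Vi; pose x : 'rV['Z_2]_m.+1 :=
  \row_j if unlift i j is Some k then w 0 k else 0.
have xw : col' i x = w by apply/rowP => k; rewrite !mxE liftK.
have [Vx|Vx] := pselect (V x); first by exists x.
exists (x + delta_mx 0 i); first exact: idxN.
by apply/rowP => k; rewrite -xw !mxE (eq_sym _ i) (negPf (neq_lift i k)) andbF addr0.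
Qed.

End Delete.

(** * Diagonal sign matrices *)

Section Diagonal.
Variables (R : realType).

Definition sgn (a : 'Z_2) : R := (-1) ^+ a.

Lemma sgn0 : sgn 0 = 1. Proof. by []. Qed.
Lemma sgn1 : sgn 1 = -1. Proof. by rewrite /sgn expr1. Qed.

Lemma sgnD a b : sgn (a + b) = sgn a * sgn b.
Proof.
by have [->|->] := Z2_cases a; have [->|->] := Z2_cases b;
  rewrite ?addZ2 ?addr0 ?add0r ?sgn0 ?sgn1 ?mulr1 ?mul1r ?mulrNN ?mulr1.
Qed.

Lemma sgnn a : sgn a * sgn a = 1.
Proof. by rewrite -sgnD addZ2. Qed.

Lemma sgn_inj : injective sgn.
Proof.
move=> a b; have [->|->] := Z2_cases a; have [->|->] := Z2_cases b;
  rewrite ?sgn0 ?sgn1 // => E; exfalso; lra.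
Qed.

Lemma sqr1_sgn (x : R) : x * x = 1 -> x = sgn (if x < 0 then 1 else 0).
Proof.
move=> /eqP; rewrite -expr2 sqrf_eq1 => /orP[]/eqP->.
  by rewrite ltr10 sgn0.
by rewrite ltrN10 sgn1.
Qed.

Variable n : nat.
Implicit Types v w : 'rV['Z_2]_n.

Definition sgn_mx v : 'M[R]_n := diag_mx (map_mx sgn v).

Fact sgn_mx_orth v : sgn_mx v *m (sgn_mx v)^T == 1%:M.
Proof.
rewrite tr_diag_mx mulmx_diag; apply/eqP/matrixP => i j.
by rewrite !mxE sgnn.
Qed.

Definition diag_sign v : orthogonal_group R n := Orthogonal (sgn_mx_orth v).

Lemma diag_signE v i j : (diag_sign v : 'M[R]_n) i j = sgn (v 0 j) *+ (i == j).
Proof. by rewrite !mxE; case: eqP => [->|]. Qed.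

Lemma diag_sign_mulmx v p (x : 'M[R]_(n, p)) i j :
  ((diag_sign v : 'M[R]_n) *m x) i j = sgn (v 0 i) * x i j.
Proof. by rewrite mul_diag_mx !mxE. Qed.

Lemma diag_signD v w : diag_sign (v + w) = (diag_sign v * diag_sign w)%g.
Proof.
apply: val_inj; apply/matrixP => i j.
by rewrite /= diag_sign_mulmx !diag_signE mxE sgnD mulrnAr; case: eqP => [->|].
Qed.

Lemma diag_sign0 : diag_sign 0 = 1%g.
Proof. by apply: val_inj; apply/matrixP => i j; rewrite diag_signE !mxE sgn0. Qed.

Lemma diag_signV v : (diag_sign v)^-1%g = diag_sign v.
Proof.
by apply: (mulgI (diag_sign v)); rewrite mulgV -diag_signD sign_addxx diag_sign0.
Qed.

(** A left inverse of [diag_sign]. *)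
Definition signs_of (A : 'M[R]_n) : 'rV['Z_2]_n :=
  \row_j (if A j j < 0 then 1 else 0).

Lemma diag_signK : cancel (fun v => diag_sign v : 'M[R]_n) signs_of.
Proof.
move=> v; apply/rowP => j; rewrite mxE diag_signE eqxx mulr1n.
by have [->|->] := Z2_cases (v 0 j); rewrite ?sgn0 ?sgn1 ?ltr10 ?ltrN10.
Qed.

Lemma diag_sign_inj : injective diag_sign.
Proof. by move=> v w /(congr1 (fun B => signs_of (orth_mx B))); rewrite !diag_signK. Qed.

End Diagonal.

(** * Norms of matrices and compactness of the orthogonal group *)

Section MatrixNorm.
Variable R : realType.

Lemma ler_mx_entry m n (A : 'M[R]_(m, n)) i j : `|A i j| <= `|A|.
Proof.
rewrite [leRHS]/Num.norm /= mx_normrE.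
by rewrite (le_trans _ (le_bigmax _ _ (i, j))).
Qed.

Lemma mx_norm_ler m n (A : 'M[R]_(m, n)) (M : R) :
  0 <= M -> (forall i j, `|A i j| <= M) -> `|A| <= M.
Proof.
move=> M0 H; rewrite [leLHS]/Num.norm /= mx_normrE.
by apply/bigmax_leP; split => // -[i j] _ /=.
Qed.

Lemma mx_norm_mulmx m n p (A : 'M[R]_(m, n)) (B : 'M[R]_(n, p)) :
  `|A *m B| <= n%:R * `|A| * `|B|.
Proof.
apply: mx_norm_ler => [|i j]; first by rewrite !mulr_ge0.
rewrite mxE (le_trans (ler_norm_sum _ _ _)) //.
rewrite -mulrA mulr_natl -[X in _ *+ X]card_ord -sumr_const.
by apply: ler_sum => k _; rewrite normrM ler_pM // ler_mx_entry.
Qed.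

(** The rows of an orthogonal matrix have Euclidean length 1, which bounds their
    entries, hence the maximum norm. *)
Lemma orth_norm n (A : orthogonal_group R n) : `|A : 'M[R]_n| <= 1.
Proof.
apply: mx_norm_ler => // i j.
have /eqP/matrixP/(_ i i) := orth_mxP A; rewrite !mxE eqxx mulr1n => S1.
rewrite -(@expr_le1 _ 2) // -normrX ger0_norm ?sqr_ge0 // -[leRHS]S1.
rewrite (bigD1 j) //= !mxE -expr2 lerDl sumr_ge0 // => k _.
by rewrite mxE -expr2 sqr_ge0.
Qed.

Lemma orth_norm_mulmx n (A : orthogonal_group R n) p (x : 'M[R]_(n, p)) :
  `|(A : 'M[R]_n) *m x| <= n%:R * `|x|.
Proof.
apply: le_trans (mx_norm_mulmx _ _) _; rewrite ler_wpM2r //.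
by rewrite ler_piMr // orth_norm.
Qed.

End MatrixNorm.

Section Compactness.
Variables (R : realType) (n : nat).

(** The topology on matrices is that of entrywise convergence. *)
Lemma continuous_to_mx (T : topologicalType) p q (f : T -> 'M[R]_(p, q)) :
  (forall i j, continuous (fun x => f x i j)) -> continuous f.
Proof.
move=> fc x U [P HP sPU].
have : nbhs x [set y | forall i, forall j, P i j (f y i j)].
  by apply: filter_forall => i; apply: filter_forall => j; exact: fc (HP i j).
by apply: filterS => y /= Hy; apply: sPU.
Qed.

Lemma closed_ball_cV_compact (M : R) : compact [set x : 'cV[R]_n | `|x| <= M].
Proof.
pose K := [set v : 'rV[R]_n | forall i, (`[- M, M])%classic (v ord0 i)].
have Kc : compact K.
  by apply: (@rV_compact _ _ (fun=> `[- M, M]%classic)) => _; exact: segment_compact.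
have trc : continuous (trmx : 'rV[R]_n -> 'cV[R]_n).
  apply: continuous_to_mx => i j.
  have -> : (fun x : 'rV[R]_n => x^T i j) = (fun x => x j i).
    by apply/funext => x; rewrite mxE.
  exact: coord_continuous.
have Ic : compact (trmx @` K).
  by apply: continuous_compact => //; exact: continuous_subspaceT.
have cl : closed [set x : 'cV[R]_n | `|x| <= M].
  apply: (@preimage_closed _ _ (fun x : 'cV[R]_n => `|x|) [set y | y <= M]).
    by move=> x _; exact: norm_continuous.
  exact: closed_le.
apply: subclosed_compact cl Ic _ => x /= xM.
exists x^T; rewrite ?trmxK // => i /=; rewrite in_itv /= mxE -ler_norml.
exact: le_trans (ler_mx_entry _ _ _) xM.
Qed.

(** The orthogonal matrices, listed as vectors of length n * n, form a closed
    bounded set [K]; the group is the image of [K] under a map that is continuous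
    on [K]. *)
Lemma orthogonal_group_compact : compact [set: orthogonal_group R n].
Proof.
pose K := [set v : 'rV[R]_(n * n) | vec_mx v *m (vec_mx v)^T = 1%:M].
pose f (v : 'rV[R]_(n * n)) : orthogonal_group R n :=
  insubd (1%g : orthogonal_group R n) (vec_mx v).
have fK v : K v -> orth_mx (f v) = vec_mx v.
  by move=> /= Kv; rewrite /f insubdK // -topredE /= Kv.
have vc : continuous (vec_mx : 'rV[R]_(n * n) -> 'M[R]_n).
  apply: continuous_to_mx => i j.
  have -> : (fun x : 'rV[R]_(n * n) => vec_mx x i j) =
            (fun x => x 0 (mxvec_index i j)).
    by apply/funext => x; rewrite mxE.
  exact: coord_continuous.
have Kcl : closed K.
  have -> : K = \bigcap_i (\bigcap_j
      (fun v : 'rV[R]_(n * n) => (vec_mx v *m (vec_mx v)^T) i j)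
        @^-1` [set (1%:M : 'M[R]_n) i j]).
    apply/seteqP; split => [v Kv i _ j _ /=|v Kv /=]; first by rewrite Kv.
    by apply/matrixP => i j; apply: Kv.
  apply: closed_bigI => i _; apply: closed_bigI => j _.
  apply: preimage_closed => [v _|]; last exact: closed_eq.
  have -> : (fun v : 'rV[R]_(n * n) => (vec_mx v *m (vec_mx v)^T) i j) =
    (fun v => \sum_k v 0 (mxvec_index i k) * v 0 (mxvec_index j k)).
    by apply/funext => w; rewrite mxE; apply: eq_bigr => k _; rewrite !mxE.
  have addc : continuous (fun z : R * R => z.1 + z.2).
    by move=> z; apply: cvgD; [exact: cvg_fst|exact: cvg_snd].
  move: v; apply: (@continuous_big R _ +%R 0 xpredT addc) => k _ v.
  by apply: continuousM; exact: coord_continuous.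
have Kb : bounded_set K.
  exists 1; split => // x x1 v Kv /=; apply: mx_norm_ler => [|i j]; first lra.
  rewrite (ord1 i) -(vec_mxK v); case/mxvec_indexP: j => a b; rewrite mxvecE.
  by rewrite -fK // (le_trans (ler_mx_entry _ _ _)) // (le_trans (orth_norm _)) // ltW.
have -> : [set: orthogonal_group R n] = f @` K.
  apply/seteqP; split => // A _; exists (mxvec A).
    by rewrite /K /= mxvecK; apply/eqP/orth_mxP.
  by rewrite /f mxvecK; apply: valKd.
apply: continuous_compact; last exact: bounded_closed_compact.
apply: (@continuous_comp_initial _ _ _ (@orth_mx R n)).
apply: (@subspace_eq_continuous _ K 'M[R]_n vec_mx) => [v|].
  by rewrite inE => /fK.
exact: continuous_subspaceT.
Qed.

End Compactness.

(** * Metric forms of discreteness and cocompactness *)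

Section Criteria.
Variables (R : realType) (n : nat).
Implicit Types (Gam : groupClosed (motion R n)) (b x : 'cV[R]_n).

Definition translation b : motion R n := (1%g, b).

Lemma motion_divE (g h : motion R n) :
  g.1 = h.1 -> (g * h^-1)%g = translation (g.2 - h.2).
Proof.
case: g h => [A a] [B b] /= ->; congr (_, _) => /=; first exact: mulgV.
by rewrite mulNmx mulmxN mulmxA (eqP (orth_mxP B)) mul1mx addrC.
Qed.

(** A discrete group has a ball around 0 with no translation vector but 0.  For
    a group with finite holonomy this is equivalent to discreteness, and unlike
    discreteness it is easy to carry along coordinate changes. *)
Definition translation_gap Gam (r : R) :=
  0 < r /\ forall b, translation b \in Gam -> `|b| < r -> b = 0.

(** The orbit of the origin comes within [M] of every point.  This is
    cocompactness without the quotient space, the orthogonal part being compact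
    anyway. *)
Definition orbit_net Gam (M : R) :=
  0 <= M /\ forall x, exists2 g : motion R n, g \in Gam & `|x - g.2| <= M.

Lemma discrete_translation_gap Gam :
  discrete_subgroup Gam -> exists r, translation_gap Gam r.
Proof.
have G1 : 1%g \in Gam by exact: gpred1.
move=> /(_ 1%g G1) [_ [V V1 VG]].
case: V1 => -[U W] /= [U1 W0] UWV.
have /nbhs_ballP[r /= r0 rW] : nbhs (0 : 'cV[R]_n) W by [].
exists r; split => // b bG br.
suff : [set (1%g : motion R n)] (translation b) by case.
rewrite -VG; split => //; apply: UWV; split => /=; first exact: nbhs_singleton.
by apply: rW; rewrite mx_norm_ball /ball_ /= sub0r normrN.
Qed.

(** Two distinct sign matrices are at distance 2, so a motion of the group close
    to [g] has the linear part of [g] and differs from it by a short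
    translation. *)
Lemma translation_gap_discrete Gam r :
  (forall g, g \in Gam -> exists v, g.1 = diag_sign R v) ->
  translation_gap Gam r -> discrete_subgroup Gam.
Proof.
move=> diagG [r0 rG] g gG; split; first by rewrite inE.
exists [set h : motion R n | ball (orth_mx g.1) 1 (orth_mx h.1) /\ ball g.2 r h.2].
  exists ([set B | ball (orth_mx g.1) 1 (orth_mx B)], ball g.2 r); last by [].
  split => /=; last exact: nbhsx_ballx.
  by apply: (@initial_continuous _ _ (@orth_mx R n)); exact: nbhsx_ballx.
apply/seteqP; split => [h [/= [B1 b1] hG]|_ ->]; last first.
  by split => //=; split; exact: ballxx.
have [v gv] := diagG _ gG; have [w hw] := diagG _ hG.
have vw : v = w.
  apply/rowP => j; apply: (@sgn_inj R).
  move: B1; rewrite mx_norm_ball /ball_ /= gv hw => B1.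
  have := le_lt_trans (ler_mx_entry _ j j) B1.
  rewrite !mxE eqxx !mulr1n.
  have [->|->] := Z2_cases (v 0 j); have [->|->] := Z2_cases (w 0 j);
    rewrite ?sgn0 ?sgn1 // ?opprK ltr_norml; lra.
have hg1 : h.1 = g.1 by rewrite hw gv vw.
have h2 : h.2 = g.2.
  apply/eqP; rewrite -subr_eq0; apply/eqP/rG.
    by rewrite -motion_divE // gpredF.
  by move: b1; rewrite mx_norm_ball /ball_ /= distrC.
by case: h g hg1 h2 {gG gv hG hw B1 b1} => [A a] [B b] /= -> ->.
Qed.

(** Every class has a representative with a translation part of norm at most
    n * M, and such motions form a compact set. *)
Lemma orbit_net_cocompact Gam M : orbit_net Gam M -> cocompact_subgroup Gam.
Proof.
move=> [M0 HM].
pose Q := quotient_topology {eq_quot (coset_rel Gam)}%qT.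
rewrite /cocompact_subgroup -/Q.
pose K := [set: orthogonal_group R n] `*` [set b : 'cV[R]_n | `|b| <= n%:R * M].
have Kc : compact K.
  by apply: compact_setX; [exact: orthogonal_group_compact|exact: closed_ball_cV_compact].
have -> : [set: Q] = (\pi_Q%qT : motion R n -> Q) @` K.
  apply/seteqP; split => // q _.
  set A := (repr q).1; set a := (repr q).2.
  have [g gG gM] := HM (- ((A : 'M[R]_n)^T *m a)).
  exists (repr q * g)%g.
    split => //=; rewrite -/A -/a.
    have -> : (A : 'M[R]_n) *m g.2 + a =
              (A : 'M[R]_n) *m - (- ((A : 'M[R]_n)^T *m a) - g.2).
      by rewrite opprB opprK mulmxDr mulmxA (eqP (orth_mxP A)) mul1mx.
    apply: le_trans (orth_norm_mulmx _ _) _.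
    by rewrite normrN ler_wpM2l.
  rewrite -[RHS]reprK; apply/eqmodP => /=; rewrite /coset_rel.
  by rewrite invgM mulgVK gpredV.
apply: continuous_compact => //; apply: continuous_subspaceT.
exact: pi_continuous.
Qed.

(** Right multiplication by [g] is continuous.  Only the size of the translation
    part matters, since the open sets of the quotient used below are defined by
    it. *)
Lemma nbhs_motion_norm_lt (g x : motion R n) (C : R) :
  `|(x * g)%g.2| < C -> nbhs x [set y | `|(y * g)%g.2| < C].
Proof.
move=> xC; set c : 'cV[R]_n := g.2.
pose D : R := n%:R * `|c| + 1.
have D0 : 0 < D by rewrite ltr_wpDl ?mulr_ge0.
pose d := (C - `|(x * g)%g.2|) / D.
have d0 : 0 < d by rewrite divr_gt0 ?subr_gt0.
exists ([set B | ball (orth_mx x.1) d (orth_mx B)], ball x.2 d).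
  split => /=; last exact: nbhsx_ballx.
  by apply: (@initial_continuous _ _ (@orth_mx R n)); exact: nbhsx_ballx.
case=> B b /= []; rewrite !mx_norm_ball /ball_ /= => Bd bd.
have -> : orth_mx B *m c + b =
    (orth_mx x.1 *m c + x.2) - ((orth_mx x.1 - orth_mx B) *m c + (x.2 - b)).
  by rewrite mulmxBl opprD !opprB addrACA !subrKC.
apply: le_lt_trans (ler_normB _ _) _.
rewrite -ltrBrDl; apply: le_lt_trans (ler_normD _ _) _.
have -> : C - `|orth_mx x.1 *m c + x.2| = n%:R * d * `|c| + d.
  have -> : n%:R * d * `|c| + d = d * D by rewrite /D; ring.
  by rewrite divfK ?gt_eqF.
apply: ler_ltD => //; apply: le_trans (mx_norm_mulmx _ _) _.
by rewrite ler_wpM2r // ler_wpM2l // ltW.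
Qed.

(** The classes of motions with translation part shorter than [C] form open sets
    that exhaust the quotient, so by compactness one [C] serves for all classes;
    the class of the translation by [-x] gives the point of the orbit near
    [x]. *)
Lemma cocompact_orbit_net Gam : cocompact_subgroup Gam -> exists M, orbit_net Gam M.
Proof.
rewrite /cocompact_subgroup.
set Q := quotient_topology {eq_quot (coset_rel Gam)}%qT.
pose pi (x : motion R n) : Q := (\pi_Q x)%qT.
have piP (x g : motion R n) : g \in Gam -> pi (x * g)%g = pi x.
  by move=> gG; apply/eqmodP => /=; rewrite /coset_rel invgM mulgVK gpredV.
have piE (x y : motion R n) : pi x = pi y ->
    exists2 g : motion R n, g \in Gam & y = (x * g)%g.
  by move=> /eqmodP /= xy; exists (x^-1 * y)%g => //; rewrite mulVKg.
have nbhs_pi (q : Q) (C : R) : `|(repr q).2| < C ->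
    nbhs q (pi @` [set x | `|x.2| < C]).
  move=> qC; rewrite nbhsE; exists (pi @` [set x | `|x.2| < C]) => //; split.
    rewrite /open /= /quotient_open openE => x [y yC] /piE[g gG xyg].
    apply: (@filterS _ _ _ [set z | `|(z * g^-1)%g.2| < C]).
      by move=> z zC; exists (z * g^-1)%g => //; rewrite piP // gpredV.
    by apply: nbhs_motion_norm_lt; rewrite xyg mulgK.
  by exists (repr q); [|exact: reprK].
move=> /compact_near_coveringP /(_ nat \oo
  (fun k (q : Q) => exists2 x : motion R n, pi x = q & `|x.2| <= k%:R)) [].
  move=> q _; pose C := `|(repr q).2| + 1.
  exists (pi @` [set x | `|x.2| < C], [set k : nat | C <= k%:R]) => /=.
    by split; [apply: nbhs_pi; rewrite ltrDl|exact: nbhs_infty_ger].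
  by move=> [_ k] /= [[x xC <-] Ck]; exists x => //; rewrite (le_trans (ltW xC)).
move=> N _ HN; exists N%:R; split => // x.
have [y + yN] := HN N (leqnn N) (pi (translation (- x))) I.
move=> /esym/piE[g gG yE]; exists g => //.
by move: yN; rewrite yE /= mul1mx distrC.
Qed.

End Criteria.

(** * Diagonal motions *)

Lemma ex_groupClosed (G : groupType) (P : set G) :
  P 1%g -> (forall x y, P x -> P y -> P (x * y)%g) ->
  (forall x, P x -> P x^-1%g) ->
  exists S : groupClosed G, forall x, x \in S <-> P x.
Proof.
move=> P1 PM PV; pose p : {pred G} := fun x => `[< P x >].
have p1 : 1%g \in p by apply/asboolP.
have pM : mulg_closed p.
  by move=> x y /asboolP Px /asboolP Py; apply/asboolP; exact: PM.
have pV : invg_closed p by move=> x /asboolP Px; apply/asboolP; exact: PV.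
pose S : groupClosed G := HB.pack p (isInvClosed.Build G p pV)
  (isMul1Closed.Build G p p1) (isMulClosed.Build G p pM).
by exists S => x; split => [/asboolP|Px]; last exact/asboolP.
Qed.

(** The least positive element generates, if there is a positive element at all;
    it exists because the gap makes the infimum of those elements attained. *)
Lemma discrete_subgroup_cyclic (R : realType) (T : set R) (r : R) :
  T 0 -> (forall x y, T x -> T y -> T (x - y)) -> 0 < r ->
  (forall x, T x -> `|x| < r -> x = 0) ->
  exists2 t, T t & forall x, T x -> exists k : int, x = k%:~R * t.
Proof.
move=> T0 TB r0 gap.
have TN x : T x -> T (- x) by move=> Tx; rewrite -sub0r; exact: TB.
have TD x y : T x -> T y -> T (x + y).
  by move=> Tx Ty; rewrite -[y]opprK; apply: TB => //; exact: TN.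
have TM x (k : int) : T x -> T (k%:~R * x).
  move=> Tx; have Tn (j : nat) : T (j%:R * x).
    by elim: j => [|j IH]; rewrite ?mul0r // -natr1 mulrDl mul1r; exact: TD.
  case: k => j; first exact: Tn.
  by rewrite NegzE mulrNz mulNr; exact/TN/Tn.
have [[a [Ta a0]]|npos] := pselect (exists a, T a /\ 0 < a); last first.
  exists 0 => // x Tx; exists 0; rewrite mul0r; apply/eqP; rewrite eq_le.
  rewrite !leNgt; apply/andP; split; apply/negP => xlt; apply: npos.
    by exists x.
  by exists (- x); split; [exact: TN|rewrite oppr_gt0].
pose S := [set x | T x /\ 0 < x].
have hS : has_inf S.
  by split; [exists a|exists 0 => x [_ /ltW]].
have [t [Tt t0] tlt] := inf_adherent r0 hS.
have tmin x : T x -> 0 < x -> t <= x.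
  move=> Tx x0; rewrite leNgt; apply/negP => xt.
  have ix : inf S <= x by apply: ge_inf => //; exact: hS.2.
  suff : t - x = 0 by lra.
  by apply: gap; [exact: TB|rewrite ger0_norm; lra].
exists t => // x Tx; exists (Num.floor (x / t)).
set k := Num.floor _.
have kx : k%:~R * t <= x by rewrite -ler_pdivlMr // floor_le.
have xk : x < k%:~R * t + t.
  have := floorD1_gt (x / t).
  by rewrite ltr_pdivrMr // -/k intrD mulrDl mul1r.
have [//|xk'] := eqVneq x (k%:~R * t).
have : t <= x - k%:~R * t.
  by apply: tmin; [exact/TB/TM|rewrite subr_gt0 lt_neqAle eq_sym xk'].
lra.
Qed.

Section DiagonalGroup.
Variables (R : realType) (m : nat) (Gam : groupClosed (motion R m)).
Implicit Types (v w : 'rV['Z_2]_m) (b x : 'cV[R]_m).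

Definition diag_motion v b : motion R m := (diag_sign R v, b).

(** For a group of diagonal motions this is its holonomy, written additively. *)
Definition signs (G : groupClosed (motion R m)) : set 'rV['Z_2]_m :=
  [set v | exists b, diag_motion v b \in G].

Lemma diag_motionM v b w d :
  (diag_motion v b * diag_motion w d)%g =
  diag_motion (v + w) ((diag_sign R v : 'M[R]_m) *m d + b).
Proof. by congr (_, _); rewrite diag_signD. Qed.

Lemma translationE b : translation b = diag_motion 0 b.
Proof. by rewrite /diag_motion diag_sign0. Qed.

Lemma translationM b d : (translation b * translation d)%g = translation (b + d).
Proof. by congr (_, _) => /=; rewrite ?mulg1 // mul1mx addrC. Qed.

Lemma translationV b : (translation b)^-1%g = translation (- b).
Proof.
apply: (mulgI (translation b)); rewrite mulgV translationM subrr.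
by [].
Qed.

Lemma translation_conj (g : motion R m) b :
  (g * translation b * g^-1)%g = translation ((g.1 : 'M[R]_m) *m b).
Proof.
by rewrite motion_divE /= ?mulg1 // addrK.
Qed.

Lemma translation_scale b (k : int) :
  translation b \in Gam -> translation (k%:~R *: b) \in Gam.
Proof.
move=> bG; have Gn (j : nat) : translation (j%:R *: b) \in Gam.
  elim: j => [|j IH]; first by rewrite scale0r gpred1.
  by rewrite -natr1 scalerDl scale1r -translationM gpredM.
case: k => j; first exact: Gn.
by rewrite NegzE mulrNz scaleNr -translationV gpredV; exact: Gn.
Qed.

Lemma diag_motion_sqr v b : diag_motion v b \in Gam ->
  translation ((diag_sign R v : 'M[R]_m) *m b + b) \in Gam.
Proof.
by move=> G; have := gpredM _ _ G G; rewrite diag_motionM sign_addxx -translationE.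
Qed.

(** Under the hypothesis on [b] the motion is an involution: [b] is supported on
    the coordinates which it reflects. *)
Lemma torsion_free_diag_motion v b : torsion_free Gam -> diag_motion v b \in Gam ->
  (forall j, v 0 j = 0 -> b j 0 = 0) -> v = 0.
Proof.
move=> tf vG b0; apply: (@diag_sign_inj R); rewrite diag_sign0.
suff -> : diag_sign R v = (1%g : motion R m).1 by [].
rewrite -(tf (diag_motion v b) 2 vG) //.
rewrite expgS expg1 diag_motionM sign_addxx /diag_motion diag_sign0; congr (_, _).
apply/colP => j; rewrite mxE diag_sign_mulmx mxE.
have [/b0 ->|->] := Z2_cases (v 0 j); first by rewrite mulr0 addr0.
by rewrite sgn1 mulN1r addNr.
Qed.

End DiagonalGroup.

(** * Translations along the axes *)

Section Axes.
Variables (R : realType) (m : nat) (Gam : groupClosed (motion R m)).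
Implicit Types (v w : 'rV['Z_2]_m) (b x : 'cV[R]_m).

Hypothesis diagG : forall g, g \in Gam -> exists v, g.1 = diag_sign R v.
Hypothesis tfG : torsion_free Gam.
Hypothesis idxG : index_le2 (signs Gam).

Lemma diagP g : g \in Gam -> exists v, g = diag_motion v g.2.
Proof. by case: g => A a /diagG[v /= ->]; exists v. Qed.

Lemma norm_scale_delta (a : R) i : `|a *: (delta_mx i 0 : 'cV[R]_m)| <= `|a|.
Proof.
apply: mx_norm_ler => // j k; rewrite !mxE normrM ler_piMr // normr_nat.
by case: andP => //; rewrite ler01.
Qed.

Lemma neg1_notin_signs : (0 < m)%N -> ~ signs Gam (const_mx 1).
Proof.
move=> m0 [b bG].
have : const_mx 1 = 0 :> 'rV['Z_2]_m.
  by apply: (torsion_free_diag_motion tfG bG) => j; rewrite mxE => /eqP; rewrite oner_eq0.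
by move/rowP/(_ (Ordinal m0)); rewrite !mxE => /eqP; rewrite oner_eq0.
Qed.

(** To clear the coordinate [j] of a translation vector [x], add to [x] or
    subtract from it its image under an element of the group whose signs at [i]
    and [j] differ, so that the [i]-th coordinates add up and the [j]-th ones
    cancel. *)
Lemma translation_kill i (s : seq 'I_m) b : i \notin s ->
  translation b \in Gam ->
  exists x, [/\ translation x \in Gam, x i 0 = 2 ^+ size s * b i 0
    & forall j, j \in s -> x j 0 = 0].
Proof.
move=> + bG; elim: s => [_|j s IH]; first by exists b; rewrite mul1r.
rewrite inE negb_or => /andP[ij /IH[x [xG xi xs]]].
have [v [d vG] vij] := index_le2_separates idxG
  (neg1_notin_signs (leq_ltn_trans (leq0n _) (ltn_ord i))) ij.
pose y := (diag_sign R v : 'M[R]_m) *m x.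
have yG : translation y \in Gam.
  by have := translation_conj (diag_motion v d) x => /= <-; rewrite gpredM ?gpredV ?gpredM.
have syG : translation (sgn R (v 0 i) *: y) \in Gam.
  have [->|->] := Z2_cases (v 0 i); rewrite ?sgn0 ?sgn1 ?scale1r ?scaleN1r //.
  by rewrite -translationV gpredV.
exists (x + sgn R (v 0 i) *: y); split.
- by rewrite -translationM gpredM.
- by rewrite 2!mxE diag_sign_mulmx mulrA sgnn mul1r xi exprS; ring.
move=> k; rewrite 2!mxE diag_sign_mulmx inE => /predU1P[->|/xs->].
  have -> : v 0 i = 1 + v 0 j.
    by move: vij; have [->|->] := Z2_cases (v 0 i);
      have [->|->] := Z2_cases (v 0 j); rewrite ?eqxx ?addZ2 ?addr0.
  by rewrite sgnD sgn1 mulN1r mulNr mulrA sgnn mul1r subrr.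
by rewrite !mulr0 addr0.
Qed.

(** Up to a fixed power of 2, the translation lattice contains its own projection
    to each axis.  This is what makes those projections discrete. *)
Lemma axis_projection i : exists N : nat, forall b, translation b \in Gam ->
  translation ((2 ^+ N * b i 0) *: delta_mx i 0) \in Gam.
Proof.
pose s := [seq j <- enum 'I_m | j != i].
exists (size s) => b bG.
have [|x [xG xi xs]] := @translation_kill i s b _ bG.
  by rewrite mem_filter eqxx.
rewrite -xi; suff <- : x = x i 0 *: delta_mx i 0 by [].
apply/colP => j; rewrite !mxE eqxx andbT.
have [->|ji] := eqVneq j i; first by rewrite mulr1.
by rewrite mulr0 xs // mem_filter ji mem_enum.
Qed.

(** The square of such a motion is a translation by [2 b_i] along the axis [i]
    and something along the other axes, to which the projection applies. *)
Lemma axis_gap i r : translation_gap Gam r ->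
  exists2 rho, 0 < rho & forall v b, diag_motion v b \in Gam -> v 0 i = 0 ->
    `|b i 0| < rho -> b i 0 = 0.
Proof.
move=> [r0 gap]; have [N HN] := axis_projection i.
have p0 : 0 < 2 ^+ N * 2 :> R by rewrite mulr_gt0 ?exprn_gt0.
exists (r / (2 ^+ N * 2)); first by rewrite divr_gt0.
move=> v b /diag_motion_sqr/HN; rewrite mxE diag_sign_mulmx => + v0.
rewrite v0 sgn0 mul1r.
have -> : 2 ^+ N * (b i 0 + b i 0) = 2 ^+ N * 2 * b i 0 by ring.
move=> G bi.
have /(gap _ G)/colP/(_ i) : `|(2 ^+ N * 2 * b i 0) *: (delta_mx i 0 : 'cV[R]_m)| < r.
  apply: le_lt_trans (norm_scale_delta _ _) _.
  by rewrite normrM gtr0_norm // mulrC -ltr_pdivlMr.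
rewrite !mxE !eqxx mulr1 => /eqP.
by rewrite mulf_eq0 gt_eqF //= => /eqP.
Qed.

(** If the motions that preserve the direction of the axis [i] all fixed the
    [i]-th coordinate, the reversing ones would all be the same reflection of it,
    and the orbit could not come near both ends of the axis. *)
Lemma axis_moved i M : orbit_net Gam M ->
  exists v b, [/\ diag_motion v b \in Gam, v 0 i = 0 & b i 0 != 0].
Proof.
move=> [M0 net].
have far (t : R) : exists2 g : motion R m, g \in Gam & `|t - g.2 i 0| <= M.
  have [g gG gM] := net (t *: delta_mx i 0); exists g => //.
  apply: le_trans gM; apply: le_trans (ler_mx_entry _ i 0).
  by rewrite !mxE !eqxx mulr1.
have [g gG] := far (M + 1); have [h hG] := far (- (M + 1)).
rewrite !ler_norml => /andP[h1 h2] /andP[g1 g2].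
have [v gE] := diagP gG; have [w hE] := diagP hG.
rewrite gE in gG; rewrite hE in hG.
have [v0|v1] := Z2_cases (v 0 i).
  by exists v, g.2; split => //; apply/eqP; lra.
have [w0|w1] := Z2_cases (w 0 i).
  by exists w, h.2; split => //; apply/eqP; lra.
exists (v + w); exists ((diag_sign R v : 'M[R]_m) *m h.2 + g.2); split.
- by rewrite -diag_motionM gpredM.
- by rewrite mxE v1 w1 addZ2.
- by rewrite mxE diag_sign_mulmx v1 sgn1; apply/eqP; lra.
Qed.

Lemma axis_translation i M : orbit_net Gam M ->
  exists2 a : R, a != 0 & translation (a *: delta_mx i 0) \in Gam.
Proof.
move=> /(@axis_moved i)[v [b [vG v0 bi]]]; have [N HN] := axis_projection i.
exists (2 ^+ N * (2 * b i 0)); first by rewrite !mulf_neq0 // ?expf_neq0 ?pnatr_eq0.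
have := HN _ (diag_motion_sqr vG); rewrite mxE diag_sign_mulmx v0 sgn0 mul1r.
by congr (translation (_ *: _) \in Gam); ring.
Qed.

End Axes.

(** A sublattice spanned by multiples of the basis vectors has a bounded
    fundamental box; integer parts move any point into it. *)
Lemma axis_translations_net (R : realType) m (Gam : groupClosed (motion R m)) :
  (forall i, exists2 a : R, a != 0 & translation (a *: delta_mx i 0) \in Gam) ->
  exists M, orbit_net Gam M.
Proof.
move=> H.
have /boolp.choice[a Ha] i :
    exists a : R, a != 0 /\ translation (a *: delta_mx i 0) \in Gam.
  by have [a a0 aG] := H i; exists a.
exists (\sum_i `|a i|); split; first exact: sumr_ge0.
move=> x; pose k i : int := Num.floor (x i 0 / a i).
(* The lattice point at a corner of a fundamental box containing x. *)
pose y := \sum_i (k i)%:~R *: (a i *: delta_mx i 0) : 'cV[R]_m.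
exists (translation y) => /=.
  rewrite /y; elim/big_ind : _ => [|u u' uG uG'|i _]; first exact: gpred1.
  - by rewrite -translationM gpredM.
  - by apply: translation_scale; have [] := Ha i.
apply: mx_norm_ler => [|i j]; first exact: sumr_ge0.
rewrite (ord1 j) 2!mxE /y summxE (bigD1 i) //= big1 => [|l li]; last first.
  by rewrite !mxE (eq_sym i) (negPf li) !mulr0.
rewrite !mxE !eqxx mulr1 addr0.
have [ai _] := Ha i.
apply: (@le_trans _ _ `|a i|); last first.
  by rewrite (bigD1 i) //= lerDl sumr_ge0.
have -> : x i 0 - (k i)%:~R * a i = (x i 0 / a i - (k i)%:~R) * a i.
  by rewrite mulrBl divfK.
rewrite normrM ler_piMl // ger0_norm ?subr_ge0 ?floor_le //.
have := floorD1_gt (x i 0 / a i); rewrite -/(k i) intrD => kS.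
rewrite lerBlDl ltW //.
Qed.

(** * The stabiliser of a level of one coordinate *)

Lemma diag_motionV (R : realType) m (v : 'rV['Z_2]_m) (b : 'cV[R]_m) :
  (diag_motion v b)^-1%g = diag_motion v (- ((diag_sign R v : 'M[R]_m) *m b)).
Proof. by congr (_, _) => /=; rewrite ?diag_signV // tr_diag_mx mulNmx. Qed.

Lemma diag_motion_inj (R : realType) m (v w : 'rV['Z_2]_m) (b d : 'cV[R]_m) :
  diag_motion v b = diag_motion w d -> v = w /\ b = d.
Proof.
move=> E; split; last exact: (congr1 (fun g : motion R m => g.2) E).
apply: (@diag_sign_inj R); exact: (congr1 (fun g : motion R m => g.1) E).
Qed.

Section Stabiliser.
Variables (R : realType) (m : nat) (Gam : groupClosed (motion R m.+1)).
Implicit Types (v w : 'rV['Z_2]_m.+1) (b x : 'cV[R]_m.+1).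

Hypothesis tfG : torsion_free Gam.
Hypothesis idxG : index_le2 (signs Gam).
Variable r : R.
Hypothesis gapG : translation_gap Gam r.

Variable i : 'I_m.+1.

(** The second equation says that the motion maps the hyperplane x_i = c to
    itself. *)
Definition fixes_level (c : R) v b :=
  diag_motion v b \in Gam /\ sgn R (v 0 i) * c + b i 0 = c.

Definition stab_signs (c : R) : set 'rV['Z_2]_m.+1 :=
  [set v | exists b, fixes_level c v b].

Lemma fixes_levelM c v b w d : fixes_level c v b -> fixes_level c w d ->
  fixes_level c (v + w) ((diag_sign R v : 'M[R]_m.+1) *m d + b).
Proof.
move=> [vG vc] [wG wc]; split; first by rewrite -diag_motionM gpredM.
rewrite !mxE sgnD; rewrite -[in RHS]vc -[in RHS]wc.
have -> : (\sum_j diag_sign R v i j * d j 0) = sgn R (v 0 i) * d i 0.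
  by rewrite -diag_sign_mulmx mxE.
ring.
Qed.

(** The motions with sign + at [i] translate the [i]-th coordinate by the
    multiples of some [t].  Even multiples can be removed by pure translations,
    which have no effect on the signs; an odd multiple leaves one step by [t],
    and [x0] is the sign vector of a motion making that step. *)
Lemma level_translations :
  exists2 x0 : 'rV['Z_2]_m.+1, x0 0 i = 0 & forall v b, diag_motion v b \in Gam -> v 0 i = 0 ->
    exists e, (e = 0 \/ e = x0) /\
      exists2 d, diag_motion (v + e) d \in Gam & d i 0 = 0.
Proof.
(* The translations of R that the group induces on the i-th coordinate. *)
pose T := [set t : R | exists v b, [/\ diag_motion v b \in Gam, v 0 i = 0 & b i 0 = t]].
have [rho rho0 Hrho] := axis_gap tfG idxG i gapG.
have T0 : T 0 by exists 0, 0; rewrite -translationE gpred1 !mxE.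
have TB s t : T s -> T t -> T (s - t).
  move=> [v [b [vG v0 <-]]] [w [d [wG w0 <-]]].
  exists (v + w); exists ((diag_sign R v : 'M[R]_m.+1) *m
    (- ((diag_sign R w : 'M[R]_m.+1) *m d)) + b).
  split; first by rewrite -diag_motionM -diag_motionV gpredM ?gpredV.
  - by rewrite mxE v0 w0 addr0.
  - by rewrite mxE diag_sign_mulmx mxE diag_sign_mulmx v0 w0 !sgn0 !mul1r addrC.
have [|t [x0 [b0 [xG x00 b0t]]] Tt] := discrete_subgroup_cyclic T0 TB rho0.
  by move=> _ [v [b [vG v0 <-]]]; exact: Hrho vG v0.
exists x0 => // v b vG v0.
have [|k bk] := Tt (b i 0); first by exists v, b.
have [y yi yG] : exists2 y : 'cV[R]_m.+1, y i 0 = 2 * t &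
    forall l : int, translation (l%:~R *: y) \in Gam.
  exists ((diag_sign R x0 : 'M[R]_m.+1) *m b0 + b0).
    by rewrite mxE diag_sign_mulmx x00 sgn0 b0t; ring.
  by move=> l; apply: translation_scale; exact: diag_motion_sqr.
have shift (l : int) w d : diag_motion w d \in Gam -> diag_motion w (d - l%:~R *: y) \in Gam.
  move=> wG; have := gpredM _ _ (yG (- l)) wG.
  by rewrite translationE diag_motionM add0r diag_sign0 mul1mx mulrNz scaleNr.
have [l [kl|kl]] : exists l : int, k = 2 * l \/ k = 2 * l + 1.
  by exists (k %/ 2)%Z; lia.
- exists 0; split; first by left.
  exists (b - l%:~R *: y); first by rewrite addr0; exact: shift.
  by rewrite !mxE yi bk kl; ring.
exists x0; split; first by right.
have [d dG di] : exists2 d, diag_motion (v + x0) d \in Gam & d i 0 = b i 0 - t.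
  exists ((diag_sign R v : 'M[R]_m.+1) *m (- ((diag_sign R x0 : 'M[R]_m.+1) *m b0)) + b).
    by rewrite -diag_motionM -diag_motionV gpredM ?gpredV.
  by rewrite mxE diag_sign_mulmx mxE diag_sign_mulmx v0 x00 b0t sgn0; ring.
exists (d - l%:~R *: y); first exact: shift.
by rewrite !mxE yi di bk kl; ring.
Qed.

(** If some motion reflects the [i]-th coordinate, the level is the centre of
    that reflection.  Composing with the reflection then reduces every motion to
    one with sign + at [i], to which [level_translations] applies. *)
Lemma ex_level : exists c (x0 : 'rV['Z_2]_m.+1),
  forall v, signs Gam v -> stab_signs c v \/ stab_signs c (v + x0).
Proof.
have [x0 x00 Hx0] := level_translations.
have e0 e : e = 0 \/ e = x0 -> e 0 i = 0 by case=> ->; rewrite ?mxE.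
suff [c Hc] : exists c, forall v, signs Gam v ->
    exists e, (e = 0 \/ e = x0) /\ stab_signs c (v + e).
  exists c, x0 => v /Hc[e [[->|->] cv]]; last by right.
  by left; rewrite -[v]addr0.
have [[w [d [wG w1]]]|nref] :=
    pselect (exists w d, diag_motion w d \in Gam /\ w 0 i = 1).
  (* The centre of the reflection x -> - x + d_i. *)
  exists (d i 0 / 2) => v [b vG].
  have [v0|v1] := Z2_cases (v 0 i).
    have [e [ee [d1 d1G d10]]] := Hx0 _ _ vG v0.
    exists e; split => //; exists d1; split => //.
    by rewrite mxE v0 e0 // addr0 sgn0 d10; ring.
  have vwG : diag_motion (v + w) ((diag_sign R v : 'M[R]_m.+1) *m d + b) \in Gam.
    by rewrite -diag_motionM gpredM.
  have [|e [ee [d1 d1G d10]]] := Hx0 _ _ vwG; first by rewrite mxE v1 w1 addZ2.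
  exists e; split => //.
  exists ((diag_sign R (v + w + e) : 'M[R]_m.+1) *m d + d1).
  have -> : v + e = v + w + e + w.
    by rewrite -addrA (addrC e) addrA -(addrA v) sign_addxx addr0.
  split; first by rewrite -diag_motionM gpredM.
  by rewrite [X in _ + X]mxE diag_sign_mulmx d10 !mxE v1 w1 e0 //
    addZ2 addr0 add0r sgn1 sgn0; field.
(* Without reflections any level does. *)
exists 0 => v [b vG].
have [v0|v1] := Z2_cases (v 0 i); last by case: nref; exists v, b.
have [e [ee [d1 d1G d10]]] := Hx0 _ _ vG v0.
by exists e; split => //; exists d1; split => //; rewrite mulr0 d10 addr0.
Qed.

End Stabiliser.

(** * Forgetting a coordinate *)

(** The index of the signs is exactly 2, since -1 is not among them; so some basis
    vector is missing, and deleting its coordinate is the isomorphism. *)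
Lemma GHW_of_signs (R : realType) k (Del : groupClosed (motion R k.+1)) (r M : R) :
  (forall g, g \in Del -> exists v, g.1 = diag_sign R v) ->
  torsion_free Del -> index_le2 (signs Del) ->
  translation_gap Del r -> orbit_net Del M -> generalized_HW Del.
Proof.
move=> diagD tfD idxD gapD netD; split.
  split => //; first exact: translation_gap_discrete diagD gapD.
  exact: orbit_net_cocompact netD.
have [j Dj] := ex_delta_notin idxD (neg1_notin_signs tfD isT).
have holE A : holonomy Del A <-> exists2 v, signs Del v & A = diag_sign R v.
  split=> [[g gD <-]|[v [b vb] ->]]; last by exists (diag_motion v b).
  by have [v gE] := diagP diagD gD; exists v; [exists g.2; rewrite -gE|rewrite gE].
exists (fun A => col' j (signs_of (orth_mx A))).
  move=> A B; rewrite !inE => /holE[v vD ->] /holE[w wD ->].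
  by rewrite -diag_signD !diag_signK linearD.
split.
- by [].
- move=> A B; rewrite !inE => /holE[v vD ->] /holE[w wD ->].
  by rewrite !diag_signK => /(col'_inj_in idxD Dj vD wD) ->.
- move=> w _; have [v vD vw] := col'_onto w idxD Dj.
  by exists (diag_sign R v); [apply/holE; exists v|rewrite diag_signK].
Qed.

Section Forget.
Variables (R : realType) (k : nat).
Implicit Types (v w : 'rV['Z_2]_k.+2) (b x : 'cV[R]_k.+2).

(** Total on all motions, but meaningful only on diagonal ones. *)
Definition forget_coord i (g : motion R k.+2) : motion R k.+1 :=
  (diag_sign R (col' i (signs_of (orth_mx g.1))), row' i g.2).

Lemma forget_coordE i v b : forget_coord i (diag_motion v b) = diag_motion (col' i v) (row' i b).
Proof. by rewrite /forget_coord /= (@diag_signK R _ v). Qed.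

Lemma forget_coordM i v b w d :
  forget_coord i (diag_motion v b * diag_motion w d)%g =
  (forget_coord i (diag_motion v b) * forget_coord i (diag_motion w d))%g.
Proof.
rewrite diag_motionM !forget_coordE diag_motionM; congr (diag_motion _ _);
  first by rewrite linearD.
apply/colP => j.
by rewrite [LHS]mxE [LHS]mxE diag_sign_mulmx [RHS]mxE diag_sign_mulmx !mxE.
Qed.

End Forget.

Lemma fixes_levelV (R : realType) m (Gam : groupClosed (motion R m.+1)) i c v b :
  fixes_level Gam i c v b -> fixes_level Gam i c v (- ((diag_sign R v : 'M[R]_m.+1) *m b)).
Proof.
move=> [vG vc]; split; first by rewrite -diag_motionV gpredV.
rewrite mxE diag_sign_mulmx; have := sgnn R (v 0 i); move: vc; set s := sgn R _.
have -> : s * c + - (s * b i 0) = s * s * c + s * (c - s * c - b i 0) by ring.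
move=> vc ->; have -> : c - s * c - b i 0 = 0 by lra.
ring.
Qed.

(** [Del] stabilises the level provided by [ex_level] on a coordinate whose basis
    vector is missing from the signs, and [Gam'] is its image under
    [forget_coord]. *)
Lemma diagonal_descent (R : realType) k (Gam : groupClosed (motion R k.+2)) (r M : R) :
  (forall g, g \in Gam -> exists v, g.1 = diag_sign R v) ->
  torsion_free Gam -> index_le2 (signs Gam) ->
  translation_gap Gam r -> orbit_net Gam M ->
  exists (Del : groupClosed (motion R k.+2)) (Gam' : groupClosed (motion R k.+1)),
    [/\ {subset Del <= Gam}, generalized_HW Gam'
      & group_isomorphic [set` Del] [set` Gam']].
Proof.
move=> diagG tfG idxG gapG netG.
have neg1 := neg1_notin_signs tfG (ltn0Sn _).
have [i iG] := ex_delta_notin idxG neg1.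
have [c [x0 Hc]] := ex_level tfG idxG gapG i.
pose F := [set g : motion R k.+2 | exists v b,
  fixes_level Gam i c v b /\ g = diag_motion v b].
have F1 : F 1%g.
  exists 0, 0; rewrite -translationE; split => //; split.
    by rewrite -translationE gpred1.
  by rewrite !mxE sgn0; ring.
have FM x y : F x -> F y -> F (x * y)%g.
  move=> [v [b [vb ->]]] [w [d [wd ->]]]; rewrite diag_motionM.
  exists (v + w); exists ((diag_sign R v : 'M[R]_k.+2) *m d + b).
  by split => //; exact: fixes_levelM.
have FV x : F x -> F x^-1%g.
  move=> [v [b [vb ->]]]; rewrite diag_motionV; exists v; eexists; split; last by [].
  exact: fixes_levelV.
have [Del DelP] := ex_groupClosed F1 FM FV.
pose f := @forget_coord R k i.
have f1 : f 1%g = 1%g.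
  have {1}-> : 1%g = diag_motion 0 0 :> motion R k.+2 by rewrite -translationE.
  by rewrite /f forget_coordE !linear0 /diag_motion diag_sign0.
have fM x y : F x -> F y -> f (x * y)%g = (f x * f y)%g.
  by move=> [v [b [_ ->]]] [w [d [_ ->]]]; exact: forget_coordM.
have fV x : F x -> f x^-1%g = (f x)^-1%g.
  by move=> Fx; apply: (mulgI (f x)); rewrite -fM ?mulgV //; exact: FV.
(* The i-th coordinate of b is determined by v and the level c. *)
have finj x y : F x -> F y -> f x = f y -> x = y.
  move=> [v [b [[vG vc] ->]]] [w [d [[wG wc] ->]]].
  rewrite /f !forget_coordE => /diag_motion_inj[vw bd].
  have {}vw : v = w by apply: (col'_inj_in idxG iG) vw; [exists b|exists d].
  congr diag_motion => //; apply/colP => j; have [l ->|->] := unliftP i j.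
    by move/colP/(_ l): bd; rewrite !mxE.
  by move: vc wc; rewrite vw; lra.
have [Gam' Gam'P] : exists S : groupClosed (motion R k.+1), forall x, x \in S <-> (f @` F) x.
  apply: ex_groupClosed; first by exists 1%g.
    by move=> _ _ [x Fx <-] [y Fy <-]; exists (x * y)%g; [exact: FM|exact: fM].
  by move=> _ [x Fx <-]; exists x^-1%g; [exact: FV|exact: fV].
have sub : {subset Del <= Gam} by move=> g /DelP[v [b [[vG _] ->]]].
exists Del, Gam'; split => //; last first.
  exists f; first by move=> x y; rewrite !inE => /DelP Fx /DelP Fy; exact: fM.
  split.
  - by move=> x /DelP Fx; apply/Gam'P; exists x.
  - by move=> x y; rewrite !inE => /DelP Fx /DelP Fy; exact: finj.
  - by move=> y /Gam'P[x Fx <-]; exists x => //; apply/DelP.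
have tf' : torsion_free Gam'.
  move=> _ n /Gam'P[x Fx <-] n0 xn.
  have [Fn fn] : F (x ^+ n)%g /\ f (x ^+ n)%g = (f x ^+ n)%g.
    elim: n {n0 xn} => [|n [Fn fn]]; first by rewrite !expg0.
    by rewrite !expgS fM // fn; split => //; exact: FM.
  suff -> : x = 1%g by [].
  have xG : x \in Gam by apply: sub; apply/DelP.
  by apply: (tfG _ n) => //; apply: finj => //; rewrite fn f1.
have diag' g : g \in Gam' -> exists v, g.1 = diag_sign R v.
  by move=> /Gam'P[_ [v [b [_ ->]]] <-]; rewrite /f forget_coordE; exists (col' i v).
have signs'P w : signs Gam' w <-> exists2 v, stab_signs Gam i c v & col' i v = w.
  split=> [[d /Gam'P[_ [v [b [vb ->]]]]]|[v [b vb] <-]].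
    by rewrite /f forget_coordE => /diag_motion_inj[<- _]; exists v => //; exists b.
  exists (row' i b); apply/Gam'P; exists (diag_motion v b); first by exists v, b.
  exact: forget_coordE.
have idx' : index_le2 (signs Gam').
  split.
  - by exists 0; rewrite -translationE; exact: gpred1.
  - move=> x y [b xb] [d yd]; exists ((diag_sign R x : 'M[R]_k.+1) *m d + b).
    by rewrite -diag_motionM gpredM.
  move=> x y; have [v vG <-] := col'_onto x idxG iG; have [w wG <-] := col'_onto y idxG iG.
  move=> nv nw; apply/signs'P; exists (v + w); last by rewrite linearD.
  have [cv|[b vb]] := Hc _ vG; first by case: nv; apply/signs'P; exists v.
  have [cw|[d wd]] := Hc _ wG; first by case: nw; apply/signs'P; exists w.
  have := fixes_levelM vb wd.
  by rewrite addrACA sign_addxx addr0; eexists; eassumption.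
have gap' : translation_gap Gam' r.
  case: gapG => r0 gap; split => // d.
  move=> /Gam'P[_ [v [b [[vG vc] ->]]]]; rewrite /f forget_coordE translationE.
  move=> /diag_motion_inj[v0 <-] br.
  have {}v0 : v = 0.
    by apply: (col'_inj_in idxG iG); [exists b|exact: idx0|rewrite linear0].
  move: vc; rewrite v0 mxE sgn0 mul1r => vc.
  suff -> : b = 0 by rewrite linear0.
  apply: gap; first by rewrite translationE -v0.
  apply: le_lt_trans br; apply: mx_norm_ler => // j l; rewrite (ord1 l).
  have [p ->|->] := unliftP i j; last first.
    rewrite (_ : b i 0 = 0) ?normr0 //; lra.
  by have := ler_mx_entry (row' i b) p 0; rewrite mxE.
have [M' net'] : exists M', orbit_net Gam' M'.
  apply: axis_translations_net => j.
  have [a a0 aG] := axis_translation diagG tfG idxG (lift i j) netG.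
  exists a => //; apply/Gam'P; exists (translation (a *: delta_mx (lift i j) 0)).
    rewrite translationE; exists 0, (a *: delta_mx (lift i j) 0); split => //.
    split; first by rewrite -translationE.
    by rewrite !mxE (negPf (neq_lift i j)) sgn0 /= mulr0 mul1r addr0.
  rewrite translationE /f forget_coordE linear0 -translationE; congr translation.
  apply/colP => l; rewrite !mxE; congr (_ * (_ && _)%:R).
  by rewrite (inj_eq lift_inj).
exact: GHW_of_signs diag' tf' idx' gap' net'.
Qed.

(** * Orthogonal diagonalisation *)

Lemma diagonalizable_involution (F : numFieldType) n (A : 'M[F]_n) :
  A *m A = 1%:M -> diagonalizable A.
Proof.
case: n A => [|n] A AA.
  by exists 1%:M; [exact: unitmx1|apply/diagonalizable_forPp => -[]].
apply/diagonalizableP; exists [:: 1; -1].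
  by rewrite /= inE -subr_eq0 opprK -mulr2n pnatr_eq0.
apply: mxminpoly_min.
rewrite !big_cons big_nil mulr1 polyCN opprK.
rewrite rmorphM rmorphB rmorphD /= horner_mx_X horner_mx_C.
by rewrite -[_ * _]/(_ *m _) mulmxBl !mulmxDr AA !mulmx1 mul1mx [A + _]addrC subrr.
Qed.

Section Diagonalise.
Variables (R : realType) (n k : nat) (h : 'rV['Z_2]_k -> orthogonal_group R n).
Hypothesis nk : n = k.+1.
Hypothesis hinj : injective h.
Hypothesis hD : forall v w, h (v + w) = (h v * h w)%g.
Hypothesis hN1 : forall v, orth_mx (h v) <> - 1%:M.

(** Commuting involutions have a common eigenbasis, the rows of some invertible
    [P].  Their characters are pairwise distinct because their signs have index 2
    and omit -1.  Eigenvectors of symmetric matrices with distinct characters are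
    orthogonal, so the Gram matrix [P P^T] is diagonal, and it only remains to
    normalise the rows. *)
Lemma orthogonal_diagonalisation :
  exists (P : orthogonal_group R n) (u : 'rV['Z_2]_k -> 'rV['Z_2]_n),
    index_le2 (range u) /\ forall v, (P * h v * P^-1)%g = diag_sign R (u v).
Proof.
pose A v : 'M[R]_n := orth_mx (h v).
have AD v w : A (v + w) = A v *m A w by rewrite /A hD.
have h0 : h 0 = 1%g by apply: (mulgI (h 0)); rewrite -hD addr0 mulg1.
have AA v : A v *m A v = 1%:M by rewrite -AD sign_addxx /A h0.
have AT v : (A v)^T = A v.
  by rewrite -[LHS]mul1mx -(AA v) -mulmxA (eqP (orth_mxP (h v))) mulmx1.
have [P Pu /allP PD] : codiagonalizable [seq A v | v <- enum {: 'rV['Z_2]_k}].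
  apply/codiagonalizableP; split.
    move=> _ _ /mapP[v _ ->] /mapP[w _ ->].
    by rewrite /comm_mx -!AD addrC.
  by move=> _ /mapP[v _ ->]; exact: diagonalizable_involution.
pose D v := P *m A v *m invmx P.
have DP v : D v *m P = P *m A v by rewrite mulmxKV.
have DD v w : D v *m D w = D (v + w) by rewrite /D AD !mulmxA mulmxKV.
have D0 v i j : i != j -> D v i j = 0.
  move=> ij; have /PD : A v \in [seq A v | v <- enum {: 'rV['Z_2]_k}].
    by apply: map_f; rewrite mem_enum.
  by move=> /(diagonalizable_forP _ Pu)/(_ i j); apply.
have D00 : D 0 = 1%:M by rewrite /D /A h0 mulmx1 mulmxV.
clearbody D.
pose u v := signs_of (D v).
have Du v : D v = sgn_mx R (u v).
  apply/matrixP => i j; rewrite !mxE.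
  have [<-|ij] := eqVneq i j; last by rewrite D0.
  rewrite mulr1n; apply: sqr1_sgn.
  have /matrixP/(_ i i) := DD v v.
  rewrite sign_addxx D00 !mxE eqxx (bigD1 i) //= big1 ?addr0 //.
  by move=> l li; rewrite D0 ?mul0r // eq_sym.
have uinj : injective u.
  move=> v w uvw; apply/hinj/val_inj => /=.
  by rewrite -[LHS](mulKmx Pu) -[RHS](mulKmx Pu) -!DP !Du uvw.
have uD : {morph u : v w / v + w}.
  move=> v w; rewrite /u -DD !Du.
  rewrite -[_ *m _]/(orth_mx (diag_sign R (u v) * diag_sign R (u w))%g).
  by rewrite -diag_signD !(@diag_signK R n (_ : 'rV_n)).
clearbody u.
have idx := codom_index_le2 nk uinj uD.
have u1 : ~ range u (const_mx 1).
  move=> [v _ uv]; apply: (hN1 (v := v)); rewrite -[LHS](mulKmx Pu) -DP Du uv.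
  have -> : sgn_mx R (const_mx 1 : 'rV_n) = - 1%:M.
    by apply/matrixP => i j; rewrite !mxE sgn1 mulNrn.
  by rewrite mulNmx mul1mx mulmxN mulVmx.
have [G GE] : exists G : 'M[R]_n, G = P *m P^T by eexists.
have Gsym v : D v *m G = G *m D v.
  have DT : (D v)^T = D v by rewrite Du tr_diag_mx.
  have -> : G *m D v = P *m (D v *m P)^T by rewrite trmx_mul DT GE mulmxA.
  by rewrite DP trmx_mul AT GE !mulmxA DP.
have G0 i j : i != j -> G i j = 0.
  move=> ij; have [_ [v _ <-] uij] := index_le2_separates idx u1 ij.
  have /matrixP/(_ i j) := Gsym v; rewrite Du mul_diag_mx mul_mx_diag !mxE.
  by move: uij; have [->|->] := Z2_cases (u v 0 i);
    have [->|->] := Z2_cases (u v 0 j); rewrite ?eqxx // ?sgn0 ?sgn1 => _ E; lra.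
have Gpos i : 0 < G i i.
  have GiE : G i i = \sum_l P i l ^+ 2.
    by rewrite GE mxE; apply: eq_bigr => l _; rewrite mxE expr2.
  rewrite GiE lt0r sumr_ge0 ?andbT => [|l _]; last exact: sqr_ge0.
  apply/negP => /eqP/psumr_eq0P Pi.
  have : row i P = 0.
    apply/rowP => l; rewrite !mxE; apply/eqP; rewrite -sqrf_eq0; apply/eqP.
    by apply: Pi => // ? _; exact: sqr_ge0.
  move/(congr1 (mulmx^~ (invmx P))); rewrite -row_mul mulmxV // mul0mx.
  by move/rowP/(_ i); rewrite !mxE eqxx => /eqP; rewrite oner_eq0.
(* The inverse lengths of the rows of P. *)
pose N : 'rV[R]_n := \row_i (Num.sqrt (G i i))^-1.
have Oorth : (diag_mx N *m P) *m (diag_mx N *m P)^T == 1%:M.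
  rewrite trmx_mul tr_diag_mx -mulmxA (mulmxA P) -GE mul_mx_diag mul_diag_mx.
  apply/eqP/matrixP => i j; rewrite !mxE.
  have [<-|ij] := eqVneq i j; last by rewrite (G0 i j) // mul0r mulr0.
  by rewrite mulrCA -invfM -expr2 sqr_sqrtr ?ltW // mulfV // gt_eqF.
exists (Orthogonal Oorth), u; split => // v.
apply: (mulIg (Orthogonal Oorth)); rewrite mulgVK; apply: val_inj => /=.
rewrite -mulmxA -DP Du !mulmxA; congr (_ *m _).
by apply/matrixP => i j; rewrite mul_diag_mx mul_mx_diag !mxE
  mulrnAr mulrnAl mulrC; case: eqP => [->|].
Qed.

End Diagonalise.

(** * Conjugation by an orthogonal matrix *)

Section Conjugation.
Variables (R : realType) (n : nat) (Gam Gam' : groupClosed (motion R n)).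
Variable P : orthogonal_group R n.
Let p : motion R n := (P, 0).
Hypothesis conjP : forall g, g \in Gam' <-> (g ^ p)%g \in Gam.

Lemma conj_rotation (g : motion R n) :
  (g ^ p^-1)%g = ((P * g.1 * P^-1)%g, (P : 'M[R]_n) *m g.2).
Proof.
rewrite conjgE invgK mulgA; congr (_, _) => /=.
by rewrite mulmx0 mulmx0 addr0 add0r.
Qed.

Lemma conj_torsion_free : torsion_free Gam -> torsion_free Gam'.
Proof.
move=> tf g k /conjP gG k0 gk; apply: (conjg_inj p).
by rewrite conj1g; apply: (tf _ k) => //; rewrite -conjXg gk conj1g.
Qed.

Lemma conj_translation_gap r : (0 < n)%N ->
  translation_gap Gam r -> translation_gap Gam' (r / n%:R).
Proof.
move=> n0 [r0 gap]; split; first by rewrite divr_gt0 ?ltr0n.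
move=> b /conjP; rewrite conjgE.
have := translation_conj p^-1%g b; rewrite invgK -mulgA => -> /gap.
rewrite ltr_pdivlMr ?ltr0n // mulrC => H br.
have /H/(congr1 (mulmx (P : 'M[R]_n))) :=
  le_lt_trans (orth_norm_mulmx (p^-1%g).1 b) br.
by rewrite mulmx0 /= mulmxA (eqP (orth_mxP P)) mul1mx.
Qed.

Lemma conj_orbit_net M : orbit_net Gam M -> orbit_net Gam' (n%:R * M).
Proof.
move=> [M0 net]; split; first by rewrite mulr_ge0.
move=> x; have [g gG gM] := net ((P : 'M[R]_n)^T *m x).
exists (g ^ p^-1)%g; first by apply/conjP; rewrite conjgKV.
rewrite conj_rotation /=.
have -> : x - (P : 'M[R]_n) *m g.2 = (P : 'M[R]_n) *m ((P : 'M[R]_n)^T *m x - g.2).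
  by rewrite mulmxBr mulmxA (eqP (orth_mxP P)) mul1mx.
by apply: le_trans (orth_norm_mulmx _ _) _; rewrite ler_wpM2l.
Qed.

End Conjugation.

(** * The holonomy of a generalized Hantzsche-Wendt group *)

Lemma holonomy_parametrisation (R : realType) n (Gam : groupClosed (motion R n)) :
  group_isomorphic (holonomy Gam) [set: 'rV['Z_2]_n.-1] ->
  exists h : 'rV['Z_2]_n.-1 -> orthogonal_group R n,
    [/\ injective h, forall v w, h (v + w) = (h v * h w)%g
      & forall A, holonomy Gam A <-> exists v, A = h v].
Proof.
move=> [f fM [_ finj fsurj]].
have /boolp.choice[h hP] v : exists A, holonomy Gam A /\ f A = v.
  by have [A AG <-] := fsurj v I; exists A.
have holM A B : holonomy Gam A -> holonomy Gam B -> holonomy Gam (A * B)%g.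
  by move=> [g gG <-] [g' gG' <-]; exists (g * g')%g => //; exact: gpredM.
exists h; split.
- by move=> v w /(congr1 f); rewrite !(hP _).2.
- move=> v w; have [hv fv] := hP v; have [hw fw] := hP w; have [hvw fvw] := hP (v + w).
  apply: finj; rewrite ?inE //; first exact: holM.
  by rewrite fM ?inE // fv fw fvw.
move=> A; split=> [AG|[v ->]]; last by have [] := hP v.
exists (f A); apply: finj; rewrite ?inE //; by have [] := hP (f A).
Qed.

(** A motion with linear part -1 is an involution. *)
Lemma neg1_notin_holonomy (R : realType) k (Gam : groupClosed (motion R k.+1)) A :
  torsion_free Gam -> holonomy Gam A -> orth_mx A <> - 1%:M.
Proof.
move=> tf [[B b] gG /= <-] AN.
have B1 : B = 1%g.
  apply: (congr1 (fun g : motion R k.+1 => g.1) (tf (B, b) 2 gG isT _)).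
  rewrite expgS expg1; congr (_, _).
    by apply: val_inj; rewrite /= AN mulNmx mul1mx opprK.
  by rewrite /= AN mulNmx mul1mx addNr.
move: AN; rewrite B1 => /matrixP/(_ 0 0); rewrite !mxE eqxx => E.
have : (1 : R) = -1 by exact: E.
lra.
Qed.

Theorem corollary3p4 (R : realType) (n : nat) (hn : (2 <= n)%N)
    (Gam : groupClosed (motion R n)) (hGam : generalized_HW Gam) :
  exists (Del : groupClosed (motion R n))
         (Gam' : groupClosed (motion R n.-1)),
    [/\ {subset Del <= Gam}, generalized_HW Gam'
      & group_isomorphic [set` Del] [set` Gam']].
Proof.
case: n hn Gam hGam => [//|[//|k]] _ Gam [[tfG dG cG] isoG].
have [h [hinj hD holE]] := holonomy_parametrisation isoG.
have hN1 v : orth_mx (h v) <> - 1%:M.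
  by apply: (neg1_notin_holonomy tfG); apply/holE; exists v.
have [P [u [idx uE]]] := orthogonal_diagonalisation erefl hinj hD hN1.
pose p : motion R k.+2 := (P, 0).
(* Gam in the coordinates of the eigenbasis. *)
have [Con ConP] : exists S : groupClosed (motion R k.+2),
    forall g, g \in S <-> (g ^ p)%g \in Gam.
  apply: ex_groupClosed => [|x y xG yG|x xG]; first by rewrite conj1g gpred1.
  - by rewrite conjMg gpredM.
  - by rewrite conjVg gpredV.
have [r gap] := discrete_translation_gap dG.
have [M net] := cocompact_orbit_net cG.
have diagC g : g \in Con -> exists2 v, range u v & g.1 = diag_sign R v.
  move=> /ConP gG; have /holE[v gv] : holonomy Gam (g ^ p)%g.1 by exists (g ^ p)%g.
  exists (u v); first by exists v.
  by rewrite -uE -gv -[in LHS](conjgK p g) conj_rotation.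
have signsC : signs Con = range u.
  apply/seteqP; split=> [v [b /diagC[w wu /diag_sign_inj->]] //|_ [v _ <-]].
  have [g gG gv] : holonomy Gam (h v) by apply/holE; exists v.
  exists ((P : 'M[R]_k.+2) *m g.2); apply/ConP.
  suff -> : diag_motion (u v) ((P : 'M[R]_k.+2) *m g.2) = (g ^ p^-1)%g by rewrite conjgKV.
  by rewrite conj_rotation gv uE.
have [Del [Gam' [sub hw [f fM [fto finj fsurj]]]]] :
  exists (Del : groupClosed (motion R k.+2)) (Gam' : groupClosed (motion R k.+1)),
    [/\ {subset Del <= Con}, generalized_HW Gam'
      & group_isomorphic [set` Del] [set` Gam']].
  apply: diagonal_descent (conj_translation_gap ConP isT gap) (conj_orbit_net ConP net).
  - by move=> g /diagC[v _ ->]; exists v.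
  - exact: conj_torsion_free ConP tfG.
  - by rewrite signsC.
have [Del' DelP] : exists S : groupClosed (motion R k.+2),
    forall g, g \in S <-> (g ^ p^-1)%g \in Del.
  apply: ex_groupClosed => [|x y xG yG|x xG]; first by rewrite conj1g gpred1.
  - by rewrite conjMg gpredM.
  - by rewrite conjVg gpredV.
exists Del', Gam'; split => //.
  by move=> g /DelP/sub/ConP; rewrite conjgKV.
exists (fun g => f (g ^ p^-1)%g).
  by move=> x y; rewrite !inE => /DelP xD /DelP yD; rewrite conjMg fM ?inE.
split.
- by move=> x /DelP; exact: fto.
- move=> x y; rewrite !inE => /DelP xD /DelP yD /finj; rewrite !inE => /(_ xD yD).
  exact: conjg_inj.
- move=> y /fsurj[x xD <-]; exists (x ^ p)%g; last by rewrite conjgK.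
  by apply/DelP; rewrite conjgK.
Qed.
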